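(* Let $F=(F_1,\dots,F_n)$ be a sequence of linearly independent symmetric matrices in $M_n(k)$, let $C(F)$ be the associated graded Clifford algebra, $R:=k[y_1,\dots,y_n]$, and $\mathcal F:=\sum_{m=1}^nF_my_m\in M_n(R)$. If $\det\mathcal F\neq0$, then $$Z(C(F))=\begin{cases}R&\text{if } n \text{ is even},\\ R+Rg\ \text{ for some } g\in C(F)_n \text{ such that } g^2=\det\mathcal F&\text{if } n\text{ is odd}.\end{cases}$$
   Context: $k$ is an algebraically closed field of characteristic $0$. The graded Clifford algebra is $$C(F)=k\langle x_1,\dots,x_n,y_1,\dots,y_n\rangle/\Big(x_ix_j+x_jx_i-\sum_{m=1}^n(F_m)_{ij}y_m,\; x_iy_j-y_jx_i,\; y_iy_j-y_jy_i\Big)_{1\le i,j\le n},$$ graded by $\deg x_i=1$, $\deg y_j=2$. The natural map $R=k[y_1,\dots,y_n]\to C(F)$ is injective with central image, and $R$ is identified with its image. $Z(-)$ denotes the center and $C(F)_n$ the degree-$n$ component. *)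

(* Defs.v *)
From HB Require Import structures.
From mathcomp Require Import all_boot all_order all_algebra.
From mathcomp Require Import generic_quotient ring_quotient boolp.
(* mpoly comes after monalg, so that mmap and 'X_i are those of mpoly. *)
From mathcomp Require Import monalg.
From mathcomp Require Import mpoly.

Set Implicit Arguments.
Unset Strict Implicit.
Unset Printing Implicit Defensive.

Import GRing.Theory.

Local Open Scope ring_scope.
Local Open Scope quotient_scope.

Definition word (I : choiceType) : monomType := MonomialDef.clone {fmonom I} _.

(* {malg k[word I]} itself is a ring with these operations, but its product is
   transparent, which makes conversion between distinct products explode. *)
Definition free_alg (k : comNzRingType) (I : choiceType) : Type :=
  {malg k[word I]}.

HB.lock Definition free_mul (k : comNzRingType) (I : choiceType)
  (u v : {malg k[word I]}) : {malg k[word I]} := u * v.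

HB.lock Definition fvar (k : comNzRingType) (I : choiceType) (i : I) :
  free_alg k I := mkmalgU (fmu i : word I) 1.

Section FreeAlgebra.
Variables (k : comNzRingType) (I : choiceType).

HB.instance Definition _ := GRing.Lmodule.on (free_alg k I).

Let free_mulE (u v : {malg k[word I]}) : free_mul u v = u * v.
Proof. by rewrite free_mul.unlock. Qed.

Lemma free_mulA : associative (@free_mul k I).
Proof. by move=> u v w; rewrite !free_mulE mulrA. Qed.

Lemma free_mul1g : left_id (1 : {malg k[word I]}) (@free_mul k I).
Proof. by move=> u; rewrite free_mulE mul1r. Qed.

Lemma free_mulg1 : right_id (1 : {malg k[word I]}) (@free_mul k I).
Proof. by move=> u; rewrite free_mulE mulr1. Qed.

Lemma free_mulDl : left_distributive (@free_mul k I) +%R.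
Proof. by move=> u v w; rewrite !free_mulE mulrDl. Qed.

Lemma free_mulDr : right_distributive (@free_mul k I) +%R.
Proof. by move=> u v w; rewrite !free_mulE mulrDr. Qed.

Lemma free_1_neq0 : (1 : {malg k[word I]}) != 0.
Proof. exact: oner_neq0. Qed.

HB.instance Definition _ := GRing.Zmodule_isNzRing.Build (free_alg k I)
  free_mulA free_mul1g free_mulg1 free_mulDl free_mulDr free_1_neq0.

Lemma free_scaleAl (c : k) (u v : {malg k[word I]}) :
  c *: free_mul u v = free_mul (c *: u) v.
Proof. by rewrite !free_mulE; exact: monalg.fgscaleAl. Qed.

Lemma free_scaleAr (c : k) (u v : {malg k[word I]}) :
  c *: free_mul u v = free_mul u (c *: v).
Proof.
have cC (w : {malg k[word I]}) : w * malgC c = c *: w.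
  rewrite monalg.malgM_def monalg.malgZ_def monalg.fgmulgU.
  by apply: eq_bigr => m _; rewrite mulm1 mulrC.
by rewrite !free_mulE -!cC mulrA.
Qed.

HB.instance Definition _ :=
  GRing.Lmodule_isLalgebra.Build k (free_alg k I) free_scaleAl.
HB.instance Definition _ :=
  GRing.Lalgebra_isAlgebra.Build k (free_alg k I) free_scaleAr.

(* p lies in the k-span of the words of weight d, the letter i weighing wt i;
   0 is homogeneous of every degree. *)
Definition free_homog (wt : I -> nat) (d : nat) (p : free_alg k I) : Prop :=
  forall w : word I,
    monalg.mcoeff w p != 0 -> (\sum_(i <- w) wt i)%N = d.

End FreeAlgebra.

Inductive ideal_gen (A : nzRingType) (S : A -> Prop) : A -> Prop :=
| ideal_gen_in r of S r : ideal_gen S r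
| ideal_gen_0 : ideal_gen S 0
| ideal_gen_add u v of ideal_gen S u & ideal_gen S v : ideal_gen S (u + v)
| ideal_gen_mull a u of ideal_gen S u : ideal_gen S (a * u)
| ideal_gen_mulr a u of ideal_gen S u : ideal_gen S (u * a).

Definition ring_center (A : pzRingType) (z : A) : Prop :=
  forall a : A, GRing.comm z a.

Section Clifford.
Variables (k : fieldType) (n : nat) (F : n.-tuple 'M[k]_n).

(* inl i is the letter x_i, inr j the letter y_j *)
Local Notation letter := ('I_n + 'I_n)%type.
Local Notation A := (free_alg k letter).
Local Notation x i := (@fvar k letter (inl i)).
Local Notation y j := (@fvar k letter (inr j)).

Inductive clifford_rel : A -> Prop :=
| clifford_rel_xx (i j : 'I_n) : clifford_rel
    (x i * x j + x j * x i - \sum_(m < n) tnth F m i j *: y m)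
| clifford_rel_xy (i j : 'I_n) : clifford_rel (x i * y j - y j * x i)
| clifford_rel_yy (i j : 'I_n) : clifford_rel (y i * y j - y j * y i).

Definition clifford_ideal : {pred A} :=
  fun p => `[< ideal_gen clifford_rel p >].

Lemma clifford_idealP p :
  reflect (ideal_gen clifford_rel p) (p \in clifford_ideal).
Proof. exact: asboolP. Qed.

Lemma clifford_ideal_zmod_closed : zmod_closed clifford_ideal.
Proof.
split=> [|p q /clifford_idealP pI /clifford_idealP qI]; apply/clifford_idealP.
  exact: ideal_gen_0.
by apply: ideal_gen_add => //; rewrite -mulN1r; exact: ideal_gen_mull.
Qed.

HB.instance Definition _ :=
  GRing.isZmodClosed.Build A clifford_ideal clifford_ideal_zmod_closed.

Lemma clifford_ideal_mull a p :
  p \in clifford_ideal -> a * p \in clifford_ideal.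
Proof.
by move=> /clifford_idealP pI; apply/clifford_idealP; exact: ideal_gen_mull.
Qed.

Lemma clifford_ideal_mulr a p :
  p \in clifford_ideal -> p * a \in clifford_ideal.
Proof.
by move=> /clifford_idealP pI; apply/clifford_idealP; exact: ideal_gen_mulr.
Qed.

Lemma clifford_ideal_proper : 1 \notin clifford_ideal.
Proof.
have [aug [augB augD augM] [aug1 augZ augV]] : exists2 aug : A -> k,
    [/\ forall u v, aug (u - v) = aug u - aug v,
        forall u v, aug (u + v) = aug u + aug v &
        forall u v, aug (u * v) = aug u * aug v]
    & [/\ aug 1 = 1, forall c u, aug (c *: u) = c * aug u &
          forall l, aug (@fvar k letter l) = 0].
  exists (monalg.mcoeff (@mone (word letter))); split.
  - exact: monalg.mcoeffB.
  - exact: monalg.mcoeffD.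
  - by move=> u v; rewrite /GRing.mul /= free_mul.unlock; exact: rmorphM.
  - by rewrite monalg.mcoeff1 eqxx.
  - by move=> c u; exact: (monalg.mcoeffZ c u).
  move=> l; rewrite fvar.unlock /= monalg.mcoeffU.
  by case: eqP => // /(congr1 val) /=; rewrite fmU fm1.
have aug0 : aug 0 = 0 by rewrite -(subrr 0) augB subrr.
have augI p : ideal_gen clifford_rel p -> aug p = 0.
  elim=> {p} [_ [] i j||u v _ u0 _ v0|a u _ u0|a u _ u0].
  - have augS (r : seq 'I_n) : aug (\sum_(m <- r) tnth F m i j *: y m) = 0.
      elim: r => [|m r IHr]; first by rewrite big_nil.
      by rewrite big_cons augD augZ augV mulr0 IHr addr0.
    by rewrite augB augD !augM !augV augS subr0 mul0r addr0.
  - by rewrite augB !augM !augV mul0r subr0.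
  - by rewrite augB !augM !augV mul0r subr0.
  - exact: aug0.
  - by rewrite augD u0 v0 addr0.
  - by rewrite augM u0 mulr0.
  - by rewrite augM u0 mul0r.
by apply/negP => /clifford_idealP /augI /eqP; rewrite aug1 oner_eq0.
Qed.

Definition clifford : Type := Quotient.quot clifford_ideal.

HB.instance Definition _ :=
  ZmodQuotient.copy clifford (Quotient.quot clifford_ideal).

Definition clifford_pi (p : A) : clifford := \pi_clifford p.

Lemma clifford_pi_eq p q :
  (clifford_pi p == clifford_pi q) = (p - q \in clifford_ideal).
Proof. by rewrite Quotient.idealrBE. Qed.

Lemma clifford_pi_surj (c : clifford) : exists p, c = clifford_pi p.
Proof. by exists (repr c); rewrite /clifford_pi reprK. Qed.

Lemma clifford_piP (c : clifford) : clifford_pi (repr c) = c.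
Proof. exact: reprK. Qed.

Lemma clifford_pi_zmod : zmod_morphism clifford_pi.
Proof. by move=> p q; rewrite /clifford_pi !piE. Qed.

Definition clifford_one : clifford := clifford_pi 1.
Definition clifford_mul := lift_op2 clifford *%R.
Definition clifford_scale (a : k) := lift_op1 clifford ( *:%R a).

Lemma clifford_pi_mul p q :
  clifford_mul (clifford_pi p) (clifford_pi q) = clifford_pi (p * q).
Proof.
unlock clifford_mul; apply/eqP; rewrite clifford_pi_eq.
set p' := repr _; set q' := repr _.
have pI : p' - p \in clifford_ideal by rewrite -clifford_pi_eq clifford_piP.
have qI : q' - q \in clifford_ideal by rewrite -clifford_pi_eq clifford_piP.
have -> : p' * q' - p * q = (p' - p) * q' + p * (q' - q).
  by rewrite mulrBl mulrBr addrA subrK.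
by apply: rpredD; [exact: clifford_ideal_mulr | exact: clifford_ideal_mull].
Qed.

Lemma clifford_pi_scale a p :
  clifford_scale a (clifford_pi p) = clifford_pi (a *: p).
Proof.
unlock clifford_scale; apply/eqP.
rewrite clifford_pi_eq -scalerBr -mulr_algl.
by apply: clifford_ideal_mull; rewrite -clifford_pi_eq clifford_piP.
Qed.

Lemma clifford_mulA : associative clifford_mul.
Proof.
move=> c d e.
by rewrite -[c]clifford_piP -[d]clifford_piP -[e]clifford_piP
           !clifford_pi_mul mulrA.
Qed.

Lemma clifford_mul1 : left_id clifford_one clifford_mul.
Proof. by move=> c; rewrite -[c]clifford_piP clifford_pi_mul mul1r. Qed.

Lemma clifford_1mul : right_id clifford_one clifford_mul.
Proof. by move=> c; rewrite -[c]clifford_piP clifford_pi_mul mulr1. Qed.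

Lemma clifford_piD p q : clifford_pi p + clifford_pi q = clifford_pi (p + q).
Proof. by rewrite /clifford_pi piE. Qed.

Lemma clifford_mulDl : left_distributive clifford_mul +%R.
Proof.
move=> c d e; rewrite -[c]clifford_piP -[d]clifford_piP -[e]clifford_piP.
by rewrite clifford_piD !clifford_pi_mul clifford_piD mulrDl.
Qed.

Lemma clifford_mulDr : right_distributive clifford_mul +%R.
Proof.
move=> c d e; rewrite -[c]clifford_piP -[d]clifford_piP -[e]clifford_piP.
by rewrite clifford_piD !clifford_pi_mul clifford_piD mulrDr.
Qed.

Lemma clifford_1_neq0 : clifford_one != 0.
Proof.
have -> : 0 = clifford_pi 0 by rewrite /clifford_pi piE.
by rewrite clifford_pi_eq subr0 clifford_ideal_proper.
Qed.

HB.instance Definition _ := GRing.Zmodule_isNzRing.Build clifford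
  clifford_mulA clifford_mul1 clifford_1mul clifford_mulDl clifford_mulDr
  clifford_1_neq0.

Lemma clifford_scaleA a b c :
  clifford_scale a (clifford_scale b c) = clifford_scale (a * b) c.
Proof. by rewrite -[c]clifford_piP !clifford_pi_scale scalerA. Qed.

Lemma clifford_scale1 : left_id 1 clifford_scale.
Proof. by move=> c; rewrite -[c]clifford_piP clifford_pi_scale scale1r. Qed.

Lemma clifford_scaleDr : right_distributive clifford_scale +%R.
Proof.
move=> a c d; rewrite -[c]clifford_piP -[d]clifford_piP.
by rewrite clifford_piD !clifford_pi_scale clifford_piD scalerDr.
Qed.

Lemma clifford_scaleDl c : {morph clifford_scale^~ c : a b / a + b}.
Proof.
move=> a b; rewrite -[c]clifford_piP.
by rewrite !clifford_pi_scale clifford_piD scalerDl.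
Qed.

HB.instance Definition _ := GRing.Zmodule_isLmodule.Build k clifford
  clifford_scaleA clifford_scale1 clifford_scaleDr clifford_scaleDl.

Lemma clifford_scaleAl a c d :
  clifford_scale a (clifford_mul c d) = clifford_mul (clifford_scale a c) d.
Proof.
rewrite -[c]clifford_piP -[d]clifford_piP.
by rewrite !(clifford_pi_mul, clifford_pi_scale) scalerAl.
Qed.

Lemma clifford_scaleAr a c d :
  clifford_scale a (clifford_mul c d) = clifford_mul c (clifford_scale a d).
Proof.
rewrite -[c]clifford_piP -[d]clifford_piP.
by rewrite !(clifford_pi_mul, clifford_pi_scale) scalerAr.
Qed.

HB.instance Definition _ :=
  GRing.Lmodule_isLalgebra.Build k clifford clifford_scaleAl.
HB.instance Definition _ :=
  GRing.Lalgebra_isAlgebra.Build k clifford clifford_scaleAr.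

HB.instance Definition _ :=
  GRing.isZmodMorphism.Build A clifford clifford_pi clifford_pi_zmod.
Lemma clifford_pi_monoid : monoid_morphism clifford_pi.
Proof. by split=> // p q; rewrite -clifford_pi_mul. Qed.
HB.instance Definition _ :=
  GRing.isMonoidMorphism.Build A clifford clifford_pi clifford_pi_monoid.
Lemma clifford_pi_scalable : scalable clifford_pi.
Proof. by move=> a p; rewrite -clifford_pi_scale. Qed.
HB.instance Definition _ :=
  GRing.isScalable.Build k A clifford *:%R clifford_pi clifford_pi_scalable.

Definition clifford_x (i : 'I_n) : clifford := clifford_pi (x i).
Definition clifford_y (j : 'I_n) : clifford := clifford_pi (y j).

Definition letter_deg (l : letter) : nat := if l is inl _ then 1 else 2.

Definition clifford_homog (d : nat) (c : clifford) : Prop :=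
  exists2 p : A, free_homog letter_deg d p & c = clifford_pi p.

(* Here {mpoly k[n]} would be read as the type of that name in monalg. *)
Local Notation polyR := (mpoly n k).

Definition clifford_of_poly (p : polyR) : clifford :=
  mmap (in_alg clifford) clifford_y p.

Definition generic_form : 'M[polyR]_n :=
  \sum_(m < n) 'X_m *: map_mx (@mpolyC n k) (tnth F m).

End Clifford.

(* Main.v *)
Require Import Defs.
From HB Require Import structures.
From mathcomp Require Import all_boot all_order all_algebra.
(* The notations of monalg would capture {mpoly k[n]}. *)
From mathcomp Require Import -(notations) monalg.
From mathcomp Require Import mpoly.

(* Let a be the parity automorphism of C = C(F). The maps
   wedge i u = (x_i u + a(u) x_i)/2 and contr i u = (x_i u - a(u) x_i)/2 behave
   on C like exterior and interior products: the wedge i anticommute, the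
   contr i kill 1, and contr i wedge j + wedge j contr i is multiplication by
   G_ij/2, where G is the generic form. Combining the contr i with the adjugate
   of G gives operators dual to the wedge j up to the factor det G, so that C
   behaves like a Fock space over R: once R -> C is known to be injective, C is
   R-torsion free, the common kernel of the contr i is R, and the common kernel
   of the wedge i is R w with w = wedge_1 ... wedge_n 1. A central z has central
   even and odd parts; the even one is killed by every contr i and the odd one
   by every wedge i, so z lies in R + R w, and in R if n is even. If n is odd
   then w is central and multiplication by w exchanges wedge and contr, whence
   w^2 = +- contr_1 ... contr_n w, which a Laplace expansion evaluates to
   +- det G / 2^n. Injectivity of R -> C follows from a matrix representation,
   mapping x_i to a creation matrix plus a combination of annihilation
   matrices. *)

Set Implicit Arguments.
Unset Strict Implicit.
Unset Printing Implicit Defensive.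

Import GRing.Theory.

Local Open Scope ring_scope.

(** * Clifford algebras over a domain *)

Section CliffordOverDomain.

(* [h] stands for 1/2, [r] for the structure map and [a] for the parity
   automorphism. *)
Variables (R : idomainType) (A : nzRingType) (n : nat) (F : 'M[R]_n) (h : R).
Variables (r : {rmorphism R -> A}) (a : {rmorphism A -> A}) (x : 'I_n -> A).
Hypothesis h_half : h + h = 1.
Hypothesis r_inj : injective r.
Hypothesis r_central : forall p u, r p * u = u * r p.
Hypothesis x_anticomm : forall i j, x i * x j + x j * x i = r (F i j).
Hypothesis a_r : forall p, a (r p) = r p.
Hypothesis a_x : forall i, a (x i) = - x i.
Hypothesis A_gen : forall P : A -> Prop, P 1 ->
  (forall u v, P u -> P v -> P (u + v)) -> (forall p u, P u -> P (r p * u)) ->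
  (forall i u, P u -> P (x i * u)) -> forall u, P u.

(** * Exterior and interior multiplication operators *)

Definition wedge i u := r h * (x i * u + a u * x i).
Definition contr i u := r h * (x i * u - a u * x i).

Lemma parityK : involutive a.
Proof.
apply: A_gen => [|u v uK vK|p u uK|i u uK]; first by rewrite !rmorph1.
- by rewrite !rmorphD uK vK.
- by rewrite !rmorphM !a_r uK.
- by rewrite !rmorphM a_x rmorphN a_x opprK uK.
Qed.

Lemma half_half (u : A) : r h * (u + u) = u.
Proof. by rewrite mulrDr -mulrDl -rmorphD h_half rmorph1 mul1r. Qed.

Lemma wedgeD i : {morph wedge i : u v / u + v}.
Proof.
by move=> u v; rewrite /wedge -mulrDr rmorphD [x i * _]mulrDr mulrDl addrACA.
Qed.

Lemma contrD i : {morph contr i : u v / u + v}.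
Proof.
by move=> u v; rewrite /contr -mulrDr rmorphD [x i * _]mulrDr mulrDl opprD addrACA.
Qed.

Lemma wedgeZ i p u : wedge i (r p * u) = r p * wedge i u.
Proof.
rewrite /wedge rmorphM a_r [x i * _]mulrA -(r_central p) -!mulrA -mulrDr.
by rewrite [LHS]mulrA (r_central h) -mulrA.
Qed.

Lemma contrZ i p u : contr i (r p * u) = r p * contr i u.
Proof.
rewrite /contr rmorphM a_r [x i * _]mulrA -(r_central p) -!mulrA -mulrBr.
by rewrite [LHS]mulrA (r_central h) -mulrA.
Qed.

Lemma wedge0 i : wedge i 0 = 0.
Proof. by rewrite /wedge rmorph0 mulr0 mul0r addr0 mulr0. Qed.

Lemma contr0 i : contr i 0 = 0.
Proof. by rewrite /contr rmorph0 mulr0 mul0r subr0 mulr0. Qed.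

Lemma wedgeN i u : wedge i (- u) = - wedge i u.
Proof. by apply/eqP; rewrite -addr_eq0 -wedgeD addNr wedge0. Qed.

Lemma contr1 i : contr i 1 = 0.
Proof. by rewrite /contr rmorph1 mul1r mulr1 subrr mulr0. Qed.

Lemma mulx_wedge_contr i u : x i * u = wedge i u + contr i u.
Proof. by rewrite /wedge /contr -mulrDr addrACA subrr addr0 half_half. Qed.

Lemma parity_wedge i u : a (wedge i u) = - wedge i (a u).
Proof.
rewrite /wedge rmorphM a_r rmorphD !rmorphM a_x.
by rewrite mulrN mulNr -opprD mulrN.
Qed.

Lemma wedge_wedge i j u : wedge i (wedge j u) = r (h * h) *
  ((x i * x j * u - u * (x j * x i)) + (x i * a u * x j - x j * a u * x i)).
Proof.
rewrite {2}/wedge wedgeZ /wedge mulrA -rmorphM; congr (_ * _).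
rewrite rmorphD !rmorphM a_x parityK mulrDr mulrDl !(mulNr, mulrN) -!mulrA.
by rewrite [- _ - _]addrC addrACA.
Qed.

Lemma contr_wedge i j u : contr i (wedge j u) = r (h * h) *
  ((x i * x j * u + u * (x j * x i)) + (x i * a u * x j + x j * a u * x i)).
Proof.
rewrite {1}/wedge contrZ /contr mulrA -rmorphM; congr (_ * _).
rewrite rmorphD !rmorphM a_x parityK mulrDr mulrDl !(mulNr, mulrN) -!mulrA.
by rewrite opprD !opprK [X in _ + X]addrC addrACA.
Qed.

Lemma wedge_contr i j u : wedge i (contr j u) = r (h * h) *
  ((x i * x j * u + u * (x j * x i)) - (x j * a u * x i + x i * a u * x j)).
Proof.
rewrite {1}/contr wedgeZ /wedge mulrA -rmorphM; congr (_ * _).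
rewrite rmorphB !rmorphM a_x parityK mulrBr mulrBl !(mulNr, mulrN) -!mulrA.
by rewrite opprK opprD [X in _ + X]addrC addrACA [- _ + - _]addrC.
Qed.

(** In [wedge_wedge] the terms in [a u] are antisymmetric in [i] and [j]; the others add up to a
    commutator of [r (F i j)] with [u], which vanishes. *)
Lemma wedge_anticomm i j u : wedge i (wedge j u) = - wedge j (wedge i u).
Proof.
apply/eqP; rewrite -addr_eq0 !wedge_wedge -mulrDr addrACA.
rewrite -[X in _ + (_ + X)]opprB subrr addr0 addrACA -opprD -mulrDl -mulrDr.
by rewrite [x j * x i + _]addrC x_anticomm (r_central (F i j)) subrr mulr0.
Qed.

(** Adding the two expansions cancels the terms in [a u]. What remains is [r (h * h)] times
    [r (F i j) * u + u * r (F i j)], and [h + h = 1] removes one factor [h]. *)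
Lemma contr_wedge_anticomm i j u :
  contr i (wedge j u) = r (h * F i j) * u - wedge j (contr i u).
Proof.
apply/eqP; rewrite -subr_eq opprK contr_wedge wedge_contr -mulrDr addrACA subrr.
rewrite addr0 addrACA -mulrDl -mulrDr [x j * x i + _]addrC x_anticomm.
rewrite -r_central -mulrDl -rmorphD mulrA -rmorphM -mulrA mulrDr -mulrDl.
by rewrite h_half mul1r.
Qed.

Lemma wedge_sqr i u : wedge i (wedge i u) = 0.
Proof.
by rewrite -[LHS]half_half {2}wedge_anticomm subrr mulr0.
Qed.

(** * Spanning by iterated wedges *)

(** The [R]-span of the iterated wedges of 1 along subsequences of [s]. Splitting off the head index
    suits inductions on [s]; uniqueness of the decomposition is not built in. *)
Fixpoint wedge_span (s : seq 'I_n) (u : A) : Prop :=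
  if s is i :: s' then
    exists v w, [/\ wedge_span s' v, wedge_span s' w & u = v + wedge i w]
  else exists p, u = r p.

Lemma wedge_span0 s : wedge_span s 0.
Proof.
elim: s => [|i s IHs]; first by exists 0; rewrite rmorph0.
by exists 0, 0; rewrite wedge0 addr0.
Qed.

Lemma wedge_span1 s : wedge_span s 1.
Proof.
elim: s => [|i s IHs]; first by exists 1; rewrite rmorph1.
by exists 1, 0; rewrite wedge0 addr0; split=> //; exact: wedge_span0.
Qed.

Lemma wedge_spanD s u v :
  wedge_span s u -> wedge_span s v -> wedge_span s (u + v).
Proof.
elim: s u v => [|i s IHs] u v /=.
  by move=> [p ->] [q ->]; exists (p + q); rewrite rmorphD.
move=> [u1 [u2 [u1s u2s ->]]] [v1 [v2 [v1s v2s ->]]].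
by exists (u1 + v1), (u2 + v2); rewrite wedgeD addrACA; split=> //; exact: IHs.
Qed.

Lemma wedge_spanZ s p u : wedge_span s u -> wedge_span s (r p * u).
Proof.
elim: s u => [|i s IHs] u /=.
  by move=> [q ->]; exists (p * q); rewrite rmorphM.
move=> [v [w [vs ws ->]]]; exists (r p * v), (r p * w).
by split; [exact: IHs | exact: IHs | rewrite mulrDr wedgeZ].
Qed.

Lemma wedge_spanN s u : wedge_span s u -> wedge_span s (- u).
Proof.
by move=> us; rewrite -mulN1r -[1](rmorph1 r) -rmorphN; exact: wedge_spanZ.
Qed.

Lemma wedge_span_wedge s i u :
  i \in s -> wedge_span s u -> wedge_span s (wedge i u).
Proof.
elim: s u => [//|j s IHs] u; rewrite inE => /predU1P[->|i_s] [v [w [vs ws ->]]].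
  exists 0, v; split=> //; first exact: wedge_span0.
  by rewrite wedgeD wedge_sqr addr0 add0r.
exists (wedge i v), (- wedge i w); split; first exact: IHs.
  by apply: wedge_spanN; exact: IHs.
by rewrite wedgeD wedge_anticomm wedgeN.
Qed.

(** [contr i] moves inward past each wedge, leaving scalar multiples on the way, and finally kills
    the scalars; so no index outside [s] appears, whatever [i] is. *)
Lemma wedge_span_contr s i u : wedge_span s u -> wedge_span s (contr i u).
Proof.
elim: s u => [|j s IHs] u /=.
  by move=> [p ->]; exists 0; rewrite -[r p]mulr1 contrZ contr1 mulr0 rmorph0.
move=> [v [w [vs ws ->]]].
exists (contr i v + r (h * F i j) * w), (- contr i w); split.
- by apply: wedge_spanD; [exact: IHs | exact: wedge_spanZ].
- by apply: wedge_spanN; exact: IHs.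
- by rewrite contrD contr_wedge_anticomm wedgeN addrA.
Qed.

(** Left multiplication by [x i] is the sum of [wedge i] and [contr i], and both preserve the
    span. *)
Lemma wedge_span_full u : wedge_span (enum 'I_n) u.
Proof.
move: u; apply: A_gen; first exact: wedge_span1.
- by move=> u v; exact: wedge_spanD.
- by move=> p u; exact: wedge_spanZ.
- move=> i u us; rewrite mulx_wedge_contr; apply: wedge_spanD.
    by apply: wedge_span_wedge => //; rewrite mem_enum.
  exact: wedge_span_contr.
Qed.

(* The factor 2 cancels the [h] of [contr_wedge_anticomm]. *)
Definition dual_contr i u := \sum_j r (\adj F i j *+ 2) * contr j u.

Lemma dual_contrD i : {morph dual_contr i : u v / u + v}.
Proof.
move=> u v; rewrite /dual_contr -big_split; apply: eq_bigr => j _ /=.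
by rewrite contrD mulrDr.
Qed.

Lemma dual_contr0 i : dual_contr i 0 = 0.
Proof. by apply: big1 => j _; rewrite contr0 mulr0. Qed.

Lemma dual_contr_kernel i u : (forall j, contr j u = 0) -> dual_contr i u = 0.
Proof. by move=> u0; apply: big1 => j _; rewrite u0 mulr0. Qed.

(** The adjugate identity turns the pairing [F] between [contr] and [wedge] into a diagonal one. *)
Lemma dual_contr_wedge i j u :
  dual_contr i (wedge j u) = r (\det F *+ (i == j)) * u - wedge j (dual_contr i u).
Proof.
have -> : \det F *+ (i == j) = \sum_l \adj F i l *+ 2 * (h * F l j).
  have := congr1 (fun M : 'M_n => M i j) (mul_adj_mx F); rewrite !mxE => <-.
  apply: eq_bigr => l _.
  by rewrite mulrA mulrnAl -mulrnAr mulr2n h_half mulr1.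
rewrite rmorph_sum mulr_suml /dual_contr.
rewrite (big_morph (wedge j) (wedgeD j) (wedge0 j)) -sumrB; apply: eq_bigr => l _.
by rewrite contr_wedge_anticomm mulrBr mulrA -rmorphM wedgeZ.
Qed.

(** For [i] outside [s] the diagonal pairing vanishes, so [dual_contr i] anticommutes with every
    wedge involved until it reaches a scalar and kills it. *)
Lemma dual_contr_span s i u : i \notin s -> wedge_span s u -> dual_contr i u = 0.
Proof.
elim: s u => [|j s IHs] u /=.
  move=> _ [p ->]; apply: dual_contr_kernel => j.
  by rewrite -[r p]mulr1 contrZ contr1 mulr0.
rewrite inE negb_or => /andP[/negbTE i_j i_s] [v [w [vs ws ->]]].
rewrite dual_contrD dual_contr_wedge i_j mulr0n rmorph0 mul0r sub0r.
by rewrite (IHs _ _ vs) // (IHs _ _ ws) // wedge0 subr0.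
Qed.

Lemma dual_contr_wedge_span s i u : i \notin s -> wedge_span s u ->
  dual_contr i (wedge i u) = r (\det F) * u.
Proof.
move=> i_s us; rewrite dual_contr_wedge eqxx mulr1n.
by rewrite (dual_contr_span i_s us) wedge0 subr0.
Qed.

(** * Torsion-freeness and joint kernels *)

Hypothesis F_nondeg : \det F != 0.

(** [dual_contr i] sends [r p * (v + wedge i w)] to [r (\det F * p) * w]. Hence [w = 0] by induction
    with [\det F * p] in place of [p], and then [v = 0]. *)
Lemma wedge_span_torsion_free s p u :
  uniq s -> wedge_span s u -> p != 0 -> r p * u = 0 -> u = 0.
Proof.
elim: s p u => [|i s IHs] p u /=.
  move=> _ [q ->] p0; rewrite -rmorphM -(rmorph0 r) => /r_inj/eqP.
  by rewrite mulf_eq0 (negbTE p0) => /eqP ->.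
move=> /andP[i_s s_uniq] [v [w [vs ws ->]]] p0 pu0.
suff w0 : w = 0.
  rewrite w0 wedge0 addr0 in pu0 *; exact: IHs pu0.
apply: (IHs (\det F * p)) => //; first by rewrite mulf_neq0.
have := congr1 (dual_contr i) pu0.
rewrite mulrDr -wedgeZ dual_contrD dual_contr0.
rewrite (dual_contr_span i_s) ?add0r; last exact: wedge_spanZ.
by rewrite (dual_contr_wedge_span i_s) ?mulrA -?rmorphM //; exact: wedge_spanZ.
Qed.

Lemma wedge_inj s i u :
  uniq s -> i \notin s -> wedge_span s u -> wedge i u = 0 -> u = 0.
Proof.
move=> s_uniq i_s us iu0; apply: (wedge_span_torsion_free s_uniq us F_nondeg).
by rewrite -(dual_contr_wedge_span i_s us) iu0 dual_contr0.
Qed.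

(** [dual_contr i] isolates [r (\det F) * w], where [w] is the component at the head index [i].
    Torsion-freeness kills [w], so the indices are stripped one by one until only scalars remain. *)
Lemma contr_kernel u : (forall i, contr i u = 0) -> exists p, u = r p.
Proof.
move=> /dual_contr_kernel u0.
have: wedge_span (enum 'I_n) u by exact: wedge_span_full.
elim: (enum 'I_n) (enum_uniq 'I_n) => //= i s IHs /andP[i_s s_uniq].
move=> [v [w [vs ws u_vw]]]; apply: IHs => //.
suff -> : u = v by [].
suff w0 : w = 0 by rewrite u_vw w0 wedge0 addr0.
apply: (wedge_span_torsion_free s_uniq ws F_nondeg).
rewrite -(dual_contr_wedge_span i_s ws).
by have := u0 i; rewrite u_vw dual_contrD (dual_contr_span i_s vs) add0r.
Qed.

Definition wedge_seq s : A := foldr wedge 1 s.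

(** For [u = v + wedge i w], the vanishing of [wedge i u = wedge i v] forces [v = 0]. The other
    wedges anticommute with [wedge i], which is injective on the span of the tail, so they kill [w]
    as well. *)
Lemma wedge_kernel_span s u : uniq s -> wedge_span s u ->
  (forall i, i \in s -> wedge i u = 0) -> exists p, u = r p * wedge_seq s.
Proof.
elim: s u => [|i s IHs] u /=; first by move=> _ [p ->]; exists p; rewrite mulr1.
move=> /andP[i_s s_uniq] [v [w [vs ws u_vw]]] u0.
have v0 : v = 0.
  apply: (wedge_inj s_uniq i_s vs).
  by have := u0 i (mem_head _ _); rewrite u_vw wedgeD wedge_sqr addr0.
rewrite v0 add0r in u_vw.
have [p w_p] : exists p, w = r p * wedge_seq s.
  apply: IHs => // j j_s; apply: (wedge_inj s_uniq i_s).
    exact: wedge_span_wedge.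
  have := u0 j; rewrite inE j_s orbT u_vw wedge_anticomm => /(_ isT)/eqP.
  by rewrite oppr_eq0 => /eqP.
by exists p; rewrite u_vw w_p wedgeZ.
Qed.

(** * The top form and the center *)

Definition top_form : A := wedge_seq (enum 'I_n).

Lemma wedge_kernel u : (forall i, wedge i u = 0) -> exists p, u = r p * top_form.
Proof.
move=> u0; apply: wedge_kernel_span => //; first exact: enum_uniq.
exact: wedge_span_full.
Qed.

Lemma wedge_wedge_seq s i : i \in s -> wedge i (wedge_seq s) = 0.
Proof.
elim: s => //= j s IHs; rewrite inE => /predU1P[->|i_s]; first exact: wedge_sqr.
by rewrite wedge_anticomm IHs // wedge0 oppr0.
Qed.

Lemma parity_wedge_seq s : a (wedge_seq s) = (-1) ^+ size s * wedge_seq s.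
Proof.
elim: s => [|i s IHs] /=; first by rewrite rmorph1 mulr1.
rewrite parity_wedge IHs exprS -mulrA mulN1r; congr (- _).
by case: (odd (size s)) (signr_odd A (size s)) => <-; rewrite ?mulN1r ?wedgeN ?mul1r.
Qed.

Lemma parity_top : a top_form = (-1) ^+ n * top_form.
Proof. by rewrite parity_wedge_seq size_enum_ord. Qed.

Lemma wedge_top i : wedge i top_form = 0.
Proof. by apply: wedge_wedge_seq; rewrite mem_enum. Qed.

Lemma half_eq0 (u : A) : r h * u = 0 -> u = 0.
Proof. by move=> u0; rewrite -[u]half_half mulrDr u0 addr0. Qed.

Lemma x_central z : (forall i, z * x i = x i * z) -> forall u, z * u = u * z.
Proof.
move=> zx; apply: A_gen => [|u v zu zv|p u zu|i u zu].
- by rewrite mulr1 mul1r.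
- by rewrite mulrDr mulrDl zu zv.
- by rewrite mulrA -r_central -!mulrA zu.
- by rewrite mulrA zx -!mulrA zu.
Qed.

(** For odd [n] the top form is odd, so [wedge i top_form = 0] says that it commutes with [x i]. *)
Lemma top_central : odd n -> forall u, top_form * u = u * top_form.
Proof.
move=> n_odd; apply: x_central => i.
have := half_eq0 (wedge_top i).
rewrite parity_top -signr_odd n_odd mulN1r mulNr.
by move=> /eqP; rewrite subr_eq0 => /eqP.
Qed.

Lemma center_split z : (forall u, z * u = u * z) -> exists p q,
  z = r p + r q * top_form /\ (~~ odd n -> z = r p).
Proof.
move=> zC.
have azC i : a z * x i = x i * a z.
  have := congr1 a (zC (x i)); rewrite !rmorphM a_x mulrN mulNr.
  exact: oppr_inj.
(* [a] exchanges [z] and [a z], both of which commute with [x i]; so [contr i] kills their sum and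
   [wedge i] their difference. *)
have z0C i : contr i (z + a z) = 0.
  rewrite /contr rmorphD parityK [a z + z]addrC mulrDl zC azC -mulrDr.
  by rewrite subrr mulr0.
have z1C i : wedge i (z - a z) = 0.
  rewrite /wedge rmorphB parityK -[a z - z]opprB mulNr mulrBl zC azC -mulrBr.
  by rewrite subrr mulr0.
have [p0 z0E] := contr_kernel z0C; have [q0 z1E] := wedge_kernel z1C.
have zE : z = r (h * p0) + r (h * q0) * top_form.
  rewrite !rmorphM -mulrA -z0E -z1E -mulrDr addrACA.
  by rewrite subrr addr0 half_half.
exists (h * p0), (h * q0); split=> // /negbTE n_even.
(* For even [n] the top form is even, so the odd part of [z] is even too and therefore zero. *)
have top_even : a (z - a z) = z - a z.
  by rewrite z1E rmorphM a_r parity_top -signr_odd n_even mul1r.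
have z_even : z - a z = 0.
  by rewrite -[LHS]half_half -{1}top_even rmorphB parityK -opprB addNr mulr0.
by rewrite {1}zE [r (h * q0)]rmorphM -mulrA -z1E z_even mulr0 addr0.
Qed.

Fixpoint wedge_fun m : ('I_m -> 'I_n) -> A -> A :=
  if m is m'.+1 then fun g u => wedge (g ord0) (wedge_fun (g \o lift ord0) u)
  else fun _ u => u.

Fixpoint contr_fun m : ('I_m -> 'I_n) -> A -> A :=
  if m is m'.+1 then fun g u => contr_fun (g \o lift ord0) (contr (g ord0) u)
  else fun _ u => u.

Lemma eq_wedge_fun m (f g : 'I_m -> 'I_n) u :
  f =1 g -> wedge_fun f u = wedge_fun g u.
Proof.
elim: m f g => //= m IHm f g fg; rewrite fg; congr (wedge _ _).
by apply: IHm => i; exact: fg.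
Qed.

Lemma wedge_funE m (g : 'I_m -> 'I_n) u :
  wedge_fun g u = foldr wedge u [seq g i | i <- enum 'I_m].
Proof.
elim: m g => [|m IHm] g; first by rewrite enum_ord0.
by rewrite enum_ordSl /= IHm -map_comp.
Qed.

Lemma contr_fun0 m (f : 'I_m -> 'I_n) : contr_fun f 0 = 0.
Proof. by elim: m f => //= m IHm f; rewrite contr0 IHm. Qed.

Lemma contr_funD m (f : 'I_m -> 'I_n) : {morph contr_fun f : u v / u + v}.
Proof. by elim: m f => //= m IHm f u v; rewrite contrD IHm. Qed.

Lemma contr_funZ m (f : 'I_m -> 'I_n) p u :
  contr_fun f (r p * u) = r p * contr_fun f u.
Proof. by elim: m f u => //= m IHm f u; rewrite contrZ IHm. Qed.

(** [contr i] is moved past the wedges one at a time: passing [l] of them gives the sign, and the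
    term left at the next one is its pairing with [contr i]. *)
Lemma contr_wedge_fun m i (g : 'I_m.+1 -> 'I_n) :
  contr i (wedge_fun g 1) =
    \sum_(l < m.+1) r ((-1) ^+ l * (h * F i (g l))) * wedge_fun (g \o lift l) 1.
Proof.
elim: m g => [|m IHm] g.
  by rewrite big_ord1 /= contr_wedge_anticomm contr1 wedge0 subr0 mul1r.
rewrite -[wedge_fun g 1]/(wedge (g ord0) (wedge_fun (g \o lift ord0) 1)).
rewrite contr_wedge_anticomm IHm.
rewrite (big_morph _ (wedgeD _) (wedge0 _)) [RHS]big_ord_recl mul1r -sumrN.
congr (_ + _); apply: eq_bigr => l _.
rewrite wedgeZ lift0 exprS mulN1r mulNr rmorphN mulNr.
congr (- (_ * _)) => /=.
have -> : lift (lift ord0 l) ord0 = ord0 by apply: val_inj.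
congr (wedge _ _); apply: eq_wedge_fun => j /=; congr g; apply: val_inj.
by rewrite /= !bumpS.
Qed.

(** Laplace expansion along row 0: the first contraction gives the entries with their signs, the
    induction hypothesis the minors. *)
Lemma contr_fun_wedge_fun m (f g : 'I_m -> 'I_n) :
  contr_fun f (wedge_fun g 1) = r (\det (\matrix_(i, j) (h * F (f i) (g j)))).
Proof.
elim: m f g => [|m IHm] f g; first by rewrite det_mx00 rmorph1.
rewrite (expand_det_row _ ord0) rmorph_sum.
rewrite -[LHS]/(contr_fun (f \o lift ord0) (contr (f ord0) (wedge_fun g 1))).
rewrite contr_wedge_fun (big_morph _ (contr_funD _) (contr_fun0 _)).
apply: eq_bigr => l _; rewrite contr_funZ IHm -rmorphM /cofactor mxE add0n.
congr (r _); rewrite [RHS]mulrCA [RHS]mulrA; congr (_ * \det _).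
by apply/matrixP => i j; rewrite !mxE.
Qed.

(** For odd [n], [top_form] is odd and central: applying [a] to [u * top_form] yields an extra sign,
    and this sign is what separates [contr] from [wedge]. *)
Lemma contr_mul_top i u : odd n -> contr i (u * top_form) = wedge i u * top_form.
Proof.
move=> n_odd; rewrite /contr /wedge rmorphM parity_top -signr_odd n_odd mulN1r.
rewrite mulrN mulNr opprK -[a u * top_form * x i]mulrA (top_central n_odd (x i)).
by rewrite !mulrA -mulrDl mulrA.
Qed.

Lemma contr_fun_mul_top m (f : 'I_m -> 'I_n) u : odd n ->
  contr_fun f (u * top_form) =
  foldr wedge u (rev [seq f i | i <- enum 'I_m]) * top_form.
Proof.
move=> n_odd; elim: m f u => [|m IHm] f u; first by rewrite enum_ord0.
by rewrite enum_ordSl /= contr_mul_top // IHm -map_comp rev_cons foldr_rcons.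
Qed.

Lemma foldr_wedge i u s :
  foldr wedge (wedge i u) s = r ((-1) ^+ size s) * wedge i (foldr wedge u s).
Proof.
elim: s => [|j s IHs] /=; first by rewrite rmorph1 mul1r.
by rewrite IHs wedgeZ wedge_anticomm exprS mulN1r rmorphN mulNr mulrN.
Qed.

(** The sign is left implicit; over an algebraically closed field it will be absorbed into a scalar
    square root. *)
Lemma foldr_wedge_rev u s :
  exists e, foldr wedge u (rev s) = r ((-1) ^+ e) * foldr wedge u s.
Proof.
elim: s u => [|i s IHs] u; first by exists 0; rewrite rmorph1 mul1r.
have [e eE] := IHs (wedge i u); exists (e + size s)%N.
by rewrite rev_cons foldr_rcons eE foldr_wedge mulrA -rmorphM -exprD.
Qed.

(** Contracting [top_form] with all indices is computed twice: as the determinant of [h *: F], and,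
    through [1 * top_form], as the reversed wedge product times [top_form], which is its square up
    to sign. *)
Lemma top_sqr :
  odd n -> exists e, top_form ^+ 2 = r ((-1) ^+ e * (h ^+ n * \det F)).
Proof.
move=> n_odd.
have topE : wedge_fun id 1 = top_form by rewrite wedge_funE map_id.
have := contr_fun_wedge_fun id id.
rewrite topE -[top_form in LHS]mul1r contr_fun_mul_top //.
have [e ->] := foldr_wedge_rev 1 [seq i | i <- enum 'I_n].
rewrite map_id -/(wedge_seq _) -/top_form => det_top; exists e.
have -> : h ^+ n * \det F = \det (\matrix_(i, j) (h * F i j)).
  by rewrite -detZ; congr (\det _); apply/matrixP => i j; rewrite !mxE.
rewrite rmorphM -det_top -mulrA [RHS]mulrA -rmorphM -exprD addnn -mul2n.
by rewrite exprM sqrrN !expr1n rmorph1 mul1r expr2.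
Qed.

End CliffordOverDomain.

(** * Presentation of the graded Clifford algebra *)

Section FreeAlgebra.

Variables (k : comNzRingType) (I : choiceType).
Local Notation U w := (monalg.mkmalgU (w : word I) (1 : k) : free_alg k I).

Lemma free_mulE (u v : free_alg k I) :
  u * v = (u : monalg.malg (word I) k) * (v : monalg.malg (word I) k).
Proof. by rewrite /GRing.mul /= free_mul.unlock. Qed.

Lemma free_alg_ind (P : free_alg k I -> Prop) :
  P 1 -> (forall u v, P u -> P v -> P (u + v)) -> (forall c u, P u -> P (c *: u)) ->
  (forall i u, P u -> P (fvar k i * u)) -> forall u, P u.
Proof.
move=> P1 PD PZ Pvar u.
have P0 : P 0 by rewrite -(scale0r 1); exact: PZ.
rewrite (monalg.monalgE u).
apply: (big_ind P) => [//|//|w _].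
have -> : monalg.mkmalgU w (monalg.mcoeff w u) =
    monalg.mcoeff w u *: U w :> free_alg k I.
  apply/monalg.malgP => w'.
  by rewrite [RHS]monalg.mcoeffZ !monalg.mcoeffU mulrnAr mulr1.
apply: PZ; rewrite -(monalg.fmK w); elim: (val w) => [|i s IHs].
  by rewrite (_ : U _ = 1) // -monalg.fmoneE.
rewrite (_ : U _ = fvar k i * U (monalg.FMonom s)); first exact: Pvar.
rewrite free_mulE monalg.malgM_def fvar.unlock monalg.fgmulUU mulr1.
by congr monalg.mkmalgU; apply: val_inj; rewrite /= monalg.fmM monalg.fmU.
Qed.

Variables (B : nzRingType) (f : {rmorphism k -> B}) (v : I -> B).
Hypothesis f_central : forall c b, GRing.comm (f c) b.

Definition word_eval (w : word I) : B := \prod_(i <- w) v i.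

Lemma word_eval_mmorphism : monalg.mmorphism word_eval.
Proof.
split=> [w1 w2|]; rewrite /word_eval; last by rewrite monalg.fm1 big_nil.
by rewrite monalg.fmM big_cat.
Qed.
HB.instance Definition _ :=
  monalg.isMultiplicative.Build (word I) B word_eval word_eval_mmorphism.

Definition free_eval (u : free_alg k I) : B := monalg.mmap f word_eval u.

Lemma free_eval_zmod : zmod_morphism free_eval.
Proof. exact: monalg.mmapB. Qed.
HB.instance Definition _ :=
  GRing.isZmodMorphism.Build (free_alg k I) B free_eval free_eval_zmod.

Lemma free_evalM : {morph free_eval : p q / p * q}.
Proof.
move=> p q; rewrite free_mulE /free_eval.
exact: (monalg.commr_mmap_is_multiplicative (fun _ _ _ => f_central _ _)).1.
Qed.

Lemma free_eval1 : free_eval 1 = 1.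
Proof. exact: monalg.mmap1. Qed.

Lemma free_evalZ c p : free_eval (c *: p) = f c * free_eval p.
Proof. exact: monalg.mmapZ. Qed.

Lemma free_eval_var i : free_eval (fvar k i) = v i.
Proof.
transitivity (f 1 * word_eval (fmu i : word I)).
  by rewrite /free_eval fvar.unlock; exact: monalg.mmapU.
rewrite rmorph1 mul1r /word_eval.
by rewrite monalg.fmU big_seq1.
Qed.

End FreeAlgebra.

Section CliffordLift.

Variables (k : fieldType) (n : nat) (F : n.-tuple 'M[k]_n).

Lemma clifford_ind (P : clifford F -> Prop) :
  P 1 -> (forall u v, P u -> P v -> P (u + v)) -> (forall c u, P u -> P (c *: u)) ->
  (forall i u, P u -> P (clifford_x F i * u)) ->
  (forall j u, P u -> P (clifford_y F j * u)) -> forall u, P u.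
Proof.
move=> P1 PD PZ Px Py u; have [p ->] := clifford_pi_surj u.
move: p; apply: free_alg_ind => [|p q Pp Pq|c p Pp|[i|j] p Pp].
- by rewrite rmorph1.
- by rewrite rmorphD; exact: PD.
- by rewrite linearZ; exact: PZ.
- by rewrite rmorphM; exact: Px.
- by rewrite rmorphM; exact: Py.
Qed.

Lemma clifford_pi_rel p : clifford_rel F p -> clifford_pi F p = 0.
Proof.
move=> pF; apply/eqP; rewrite -[0](rmorph0 (clifford_pi F)) clifford_pi_eq subr0.
by apply/clifford_idealP; exact: ideal_gen_in.
Qed.

Lemma clifford_xx i j :
  clifford_x F i * clifford_x F j + clifford_x F j * clifford_x F i =
  \sum_(m < n) tnth F m i j *: clifford_y F m.
Proof.
have := clifford_pi_rel (clifford_rel_xx F i j).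
rewrite rmorphB rmorphD !rmorphM rmorph_sum => /eqP; rewrite subr_eq0 => /eqP ->.
by apply: eq_bigr => m _; exact/esym/clifford_pi_scale.
Qed.

Lemma clifford_y_central u j : GRing.comm u (clifford_y F j).
Proof.
apply/commr_sym; move: u; apply: clifford_ind => [|u v uj vj|c u uj|i u uj|i u uj].
- exact: commr1.
- exact: commrD.
- by rewrite /GRing.comm -scalerAr uj scalerAl.
- apply: commrM => //; apply/commr_sym/eqP.
  have := clifford_pi_rel (clifford_rel_xy F i j).
  by rewrite rmorphB !rmorphM => /eqP; rewrite subr_eq0.
- apply: commrM => //; apply/commr_sym/eqP.
  have := clifford_pi_rel (clifford_rel_yy F i j).
  by rewrite rmorphB !rmorphM => /eqP; rewrite subr_eq0.
Qed.

Variables (B : nzRingType) (f : {rmorphism k -> B}) (X Y : 'I_n -> B).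
Hypothesis f_central : forall c b, GRing.comm (f c) b.
Hypothesis XX : forall i j,
  X i * X j + X j * X i = \sum_(m < n) f (tnth F m i j) * Y m.
Hypothesis XY : forall i j, GRing.comm (X i) (Y j).
Hypothesis YY : forall i j, GRing.comm (Y i) (Y j).

(** Evaluation on the free algebra respects the relations, hence vanishes on the ideal and descends.
    Scalars act through the central morphism [f], which lets matrices over a polynomial ring serve
    as target. *)
Lemma clifford_lift : exists phi : {rmorphism clifford F -> B},
  [/\ forall c, phi c%:A = f c, forall i, phi (clifford_x F i) = X i
    & forall j, phi (clifford_y F j) = Y j].
Proof.
pose v (l : 'I_n + 'I_n) := match l with inl i => X i | inr j => Y j end.
pose ev := @free_eval k ('I_n + 'I_n)%type B f v.
have evM : {morph ev : p q / p * q} := free_evalM v f_central.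
have evD : {morph ev : p q / p + q} by exact: raddfD.
have evB : {morph ev : p q / p - q} by exact: raddfB.
have ev0 : ev 0 = 0 by exact: raddf0.
have evZ c p : ev (c *: p) = f c * ev p by exact: free_evalZ.
have ev_var l : ev (fvar k l) = v l by exact: free_eval_var.
have evI p : ideal_gen (clifford_rel F) p -> ev p = 0.
  elim=> {p} [_ [] i j||p q _ p0 _ q0|q p _ p0|q p _ p0].
  - rewrite evB evD !evM !ev_var (big_morph ev evD ev0).
    apply/eqP; rewrite subr_eq0 XX; apply/eqP; apply: eq_bigr => m _.
    by rewrite evZ ev_var.
  - by rewrite evB !evM !ev_var /= XY subrr.
  - by rewrite evB !evM !ev_var /= YY subrr.
  - exact: ev0.
  - by rewrite evD p0 q0 addr0.
  - by rewrite evM p0 mulr0.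
  - by rewrite evM p0 mul0r.
(* The value does not depend on the representative, since [ev] vanishes on the ideal. *)
pose phi (u : clifford F) := ev (generic_quotient.repr u).
have phi_pi p : phi (clifford_pi F p) = ev p.
  apply/eqP; rewrite -subr_eq0 /phi -evB evI //.
  by apply/clifford_idealP; rewrite -clifford_pi_eq clifford_piP.
have phi_zmod : zmod_morphism phi.
  move=> u w; rewrite -[u]clifford_piP -[w]clifford_piP -rmorphB !phi_pi.
  exact: evB.
have phi_monoid : monoid_morphism phi.
  split; first by rewrite -(rmorph1 (clifford_pi F)) phi_pi; exact: free_eval1.
  move=> u w; rewrite -[u]clifford_piP -[w]clifford_piP -rmorphM !phi_pi.
  exact: evM.
pose phiA : GRing.isZmodMorphism _ _ phi :=
  GRing.isZmodMorphism.Build (clifford F) B phi phi_zmod.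
pose phiM : GRing.isMonoidMorphism _ _ phi :=
  GRing.isMonoidMorphism.Build (clifford F) B phi phi_monoid.
pose phiR : {rmorphism clifford F -> B} := HB.pack phi phiA phiM.
exists phiR; split=> [c|i|j]; rewrite /phiR /=.
- rewrite -(rmorph1 (clifford_pi F)) -linearZ phi_pi evZ.
  by rewrite /ev free_eval1 mulr1.
- by rewrite phi_pi ev_var.
- by rewrite phi_pi ev_var.
Qed.

End CliffordLift.

(** * Homogeneous elements of the free algebra *)

Section Homogeneous.

Variables (k : comNzRingType) (I : choiceType) (wt : I -> nat).

Lemma free_homog1 : free_homog wt 0 (1 : free_alg k I).
Proof.
move=> w; rewrite monalg.mcoeff1; have [->|_] := eqVneq w mone; last by rewrite eqxx.
by rewrite monalg.fm1 big_nil.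
Qed.

Lemma free_homog_var i : free_homog wt (wt i) (fvar k i).
Proof.
move=> w; rewrite fvar.unlock monalg.mcoeffU.
have [<-|_] := eqVneq (fmu i : word I) w; last by rewrite mulr0n eqxx.
by rewrite monalg.fmU big_seq1.
Qed.

Lemma free_homogD d (p q : free_alg k I) :
  free_homog wt d p -> free_homog wt d q -> free_homog wt d (p + q).
Proof.
move=> pd qd w; rewrite monalg.mcoeffD => pq0.
have [p0|/pd //] := eqVneq (monalg.mcoeff w p) 0.
by apply: qd; move: pq0; rewrite p0 add0r.
Qed.

Lemma free_homogZ d c (p : free_alg k I) :
  free_homog wt d p -> free_homog wt d (c *: p).
Proof.
move=> pd w; rewrite monalg.mcoeffZ => cp0; apply: pd; apply: contraNneq cp0 => ->.
by rewrite mulr0.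
Qed.

Lemma free_homogM d e (p q : free_alg k I) :
  free_homog wt d p -> free_homog wt e q -> free_homog wt (d + e) (p * q).
Proof.
move=> pd qe w; rewrite free_mulE monalg.mcoeff_neq0.
move=> /monalg.msuppM_le[w1 [w2 []]].
rewrite -!monalg.mcoeff_neq0 => /pd <- /qe <- ->.
by rewrite monalg.fmM big_cat.
Qed.

End Homogeneous.

(** * Matrices satisfying canonical anticommutation relations *)

Section AnticommutationRelations.

Variable R : nzRingType.

(* The Jordan-Wigner construction of creation and annihilation matrices. *)
Lemma exists_car n : exists (N : nat) (c b : nat -> 'M[R]_N.+1),
  forall i j, (i < n)%N -> (j < n)%N ->
  [/\ c i *m c j + c j *m c i = 0, b i *m b j + b j *m b i = 0
    & c i *m b j + b j *m c i = (i == j)%:R%:M].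
Proof.
elim: n => [|n [N [c [b cb]]]]; first by exists 0%N, (fun=> 0), (fun=> 0).
(* The new pair is block off-diagonal. The old matrices act with opposite signs on the two diagonal
   blocks, so they anticommute with the new pair and keep their own relations. *)
pose ext (u : nat -> 'M[R]_N.+1) (u0 : 'M[R]_(N.+1 + N.+1)) (i : nat) :
  'M[R]_(N.+1 + N.+1) := if i == n then u0 else block_mx (u i) 0 0 (- u i).
exists (N + N.+1)%N, (ext c (block_mx 0 1%:M 0 0)), (ext b (block_mx 0 0 1%:M 0)).
rewrite -[(N + N.+1).+1]/(N.+1 + N.+1)%N => i j.
rewrite !ltnS (leq_eqVlt i) (leq_eqVlt j) /ext scalar_mx_block.
have [-> _|i_n /= i_lt] := eqVneq i n; have [-> _|j_n /= j_lt] := eqVneq j n;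
  rewrite ?[n == i]eq_sym ?eqxx ?(negbTE i_n) ?(negbTE j_n);
  rewrite !mulmx_block !add_block_mx;
  rewrite ?(mulmx0, mul0mx, addr0, add0r, mul1mx, mulmx1, addNr, subrr, block_mx0,
            mulNmx, mulmxN, opprK, scale0r) ?raddf0 ?block_mx0; try by split.
by have [-> -> ->] := cb i j i_lt j_lt; rewrite block_mx0; split.
Qed.

End AnticommutationRelations.

(** The anticommutator is bilinear and symmetric; only the mixed terms survive, and they contribute
    [H j i] and [H i j]. *)
Lemma car_anticomm (R : comNzRingType) (B : algType R) n (c b : 'I_n -> B)
    (H : 'M[R]_n) :
  (forall i j, [/\ c i * c j + c j * c i = 0, b i * b j + b j * b i = 0
    & c i * b j + b j * c i = (i == j)%:R]) ->
  forall i j, let X i := c i + \sum_l H i l *: b l in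
    X i * X j + X j * X i = (H i j + H j i)%:A.
Proof.
move=> car i j /=; pose anti (u v : B) := u * v + v * u.
have antiC u v : anti u v = anti v u by rewrite /anti addrC.
have antiDl u v w : anti (u + v) w = anti u w + anti v w.
  by rewrite /anti mulrDl mulrDr addrACA.
have antiDr u v w : anti u (v + w) = anti u v + anti u w.
  by rewrite antiC antiDl !(antiC u).
have anti_sum u l : anti u (\sum_m H l m *: b m) = \sum_m H l m *: anti u (b m).
  rewrite /anti mulr_suml mulr_sumr -big_split; apply: eq_bigr => m _ /=.
  by rewrite -scalerAr -scalerAl -scalerDr.
have cb l m : anti (c l) (\sum_q H m q *: b q) = (H m l)%:A.
  rewrite anti_sum (bigD1 l) //= big1 => [|q /negbTE q_l].
    by have [_ _] := car l l; rewrite -/(anti _ _) => ->; rewrite eqxx addr0.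
  have [_ _] := car l q; rewrite -/(anti _ _) => ->.
  by rewrite eq_sym q_l scaler0.
have bb l m : anti (\sum_q H l q *: b q) (\sum_q H m q *: b q) = 0.
  rewrite anti_sum big1 // => q _; rewrite antiC anti_sum big1 ?scaler0 // => q' _.
  by have [_] := car q q'; rewrite -/(anti _ _) => -> _; rewrite scaler0.
rewrite -/(anti _ _) antiDl !antiDr bb [X in _ + (X + _)]antiC !cb addr0.
have [+ _ _] := car i j; rewrite -/(anti _ _) => ->.
by rewrite add0r -scalerDl addrC.
Qed.

(** * The polynomial ring inside the Clifford algebra *)

Section CliffordPolynomials.

Variables (k : fieldType) (n : nat) (F : n.-tuple 'M[k]_n).

Local Notation C := (clifford F).
Local Notation rho := (clifford_of_poly F).
Local Notation polyR := {mpoly k[n]}.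

Lemma clifford_of_poly_zmod : zmod_morphism rho.
Proof. exact: mmapB. Qed.
HB.instance Definition _ :=
  GRing.isZmodMorphism.Build polyR C rho clifford_of_poly_zmod.

Lemma clifford_scalar_central (c : k) (u : C) : GRing.comm (in_alg C c) u.
Proof. by rewrite /GRing.comm mulr_algl mulr_algr. Qed.

Lemma clifford_of_poly_monoid : monoid_morphism rho.
Proof.
have [|p m m'|rhoM rho1] :=
  @commr_mmap_is_multiplicative n k C (clifford_y F) (in_alg C).
- by move=> i u; exact: clifford_y_central.
- exact: clifford_scalar_central.
- by split.
Qed.
HB.instance Definition _ :=
  GRing.isMonoidMorphism.Build polyR C rho clifford_of_poly_monoid.

Lemma clifford_of_polyC c : rho c%:MP = c%:A.
Proof. exact: mmapC. Qed.

Lemma clifford_of_polyX j : rho 'X_j = clifford_y F j.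
Proof. by rewrite /clifford_of_poly mmapX mmap1U. Qed.

Lemma clifford_of_poly_central p u : rho p * u = u * rho p.
Proof.
rewrite /clifford_of_poly /mmap mulr_suml mulr_sumr; apply: eq_bigr => m _.
apply/commr_sym/commrM; first exact/commr_sym/clifford_scalar_central.
by apply: commr_prod => i _; apply: commrX; exact: clifford_y_central.
Qed.

(** This is the hypothesis [A_gen] for [C]: the scalars and the [y_j] are both absorbed into
    [rho]. *)
Lemma clifford_of_poly_ind (P : C -> Prop) :
  P 1 -> (forall u v, P u -> P v -> P (u + v)) ->
  (forall p u, P u -> P (rho p * u)) ->
  (forall i u, P u -> P (clifford_x F i * u)) -> forall u, P u.
Proof.
move=> P1 PD PZ Px; apply: clifford_ind => // [c|j] u Pu.
  by rewrite -mulr_algl -clifford_of_polyC; exact: PZ.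
by rewrite -clifford_of_polyX; exact: PZ.
Qed.

Lemma generic_formE i j :
  generic_form F i j = \sum_(m < n) (tnth F m i j)%:MP * 'X_m.
Proof.
rewrite /generic_form summxE; apply: eq_bigr => m _.
by rewrite !mxE mulrC.
Qed.

Lemma clifford_xx_generic i j :
  clifford_x F i * clifford_x F j + clifford_x F j * clifford_x F i =
  rho (generic_form F i j).
Proof.
rewrite clifford_xx generic_formE rmorph_sum; apply: eq_bigr => m _.
by rewrite rmorphM /= clifford_of_polyC clifford_of_polyX mulr_algl.
Qed.

(** Changing the sign of every [x_i] preserves the relations: the products [x_i x_j] are unchanged
    and the [y_j] stay central. *)
Lemma clifford_parity : exists a : {rmorphism C -> C},
  (forall p, a (rho p) = rho p) /\ forall i, a (clifford_x F i) = - clifford_x F i.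
Proof.
have [|i j|i j|i j|a [a_alg a_x a_y]] := @clifford_lift k n F C (in_alg C)
    (fun i => - clifford_x F i) (clifford_y F).
- exact: clifford_scalar_central.
- rewrite !mulrNN clifford_xx; apply: eq_bigr => m _.
  by rewrite [RHS]mulr_algl.
- exact: clifford_y_central.
- exact: clifford_y_central.
exists a; split=> // p; rewrite /clifford_of_poly /mmap rmorph_sum.
apply: eq_bigr => m _; rewrite rmorphM a_alg rmorph_prod; congr (_ * _).
apply: eq_bigr => i _.
by rewrite rmorphXn a_y.
Qed.

Lemma clifford_of_poly_inj (h : k) : h + h = 1 ->
  (forall m, (tnth F m)^T = tnth F m) -> injective rho.
Proof.
move=> h_half F_sym.
have [N [c [b cb]]] := exists_car polyR n.
pose G := generic_form F.
have G_sym i j : G i j = G j i.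
  rewrite /G !generic_formE; apply: eq_bigr => m _.
  by rewrite -[tnth F m in LHS]F_sym mxE.
(* Half of [G], so that [H i j + H j i = G i j] by symmetry. *)
pose H : 'M[polyR]_n := h%:MP *: G.
pose X (i : 'I_n) : 'M[polyR]_N.+1 := c i + \sum_j H i j *: b j.
have XX i j : X i * X j + X j * X i = (G i j)%:M.
  rewrite (@car_anticomm _ 'M[polyR]_N.+1 n (fun l => c l) (fun l => b l) H).
    by rewrite -scalemx1 !mxE (G_sym j) -mulrDl -mpolyCD h_half mul1r.
  move=> l m; have [cc bb cbE] := cb l m (ltn_ord l) (ltn_ord m).
  by split=> //; rewrite -(rmorph_nat (@scalar_mx polyR N.+1)); exact: cbE.
have [|i j|i j|i j|phi [phi_alg phi_x phi_y]] :=
  @clifford_lift k n F 'M[polyR]_N.+1 (@scalar_mx polyR N.+1 \o @mpolyC n k) X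
    (fun m => ('X_m)%:M).
- by move=> u v; exact/comm_scalar_mx.
- rewrite XX generic_formE raddf_sum; apply: eq_bigr => m _ /=.
  exact: scalar_mxM.
- exact/commr_sym/comm_scalar_mx.
- exact/comm_scalar_mx.
(* [phi] after [rho] is the scalar matrix embedding; the size [N.+1] is positive, so the entry at
   [0 0] recovers [p]. *)
have phi_rho p : phi (rho p) = p%:M.
  rewrite [p in RHS]mpolyE [RHS]raddf_sum [LHS]rmorph_sum; apply: eq_bigr => m _.
  rewrite rmorphM phi_alg.
  transitivity (((p@_m)%:MP)%:M * ('X_[m])%:M : 'M[polyR]_N.+1); last first.
    by rewrite -mul_mpolyC -rmorphM.
  congr (_ * _).
  rewrite mpolyXE_id rmorph_prod (rmorph_prod (@scalar_mx polyR N.+1)).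
  by apply: eq_bigr => l _; rewrite !rmorphXn phi_y.
move=> p q pq; have := phi_rho p; rewrite pq phi_rho.
by move=> /matrixP /(_ 0 0); rewrite !mxE.
Qed.
End CliffordPolynomials.

(** * The degree of the top form *)

Section Top.
Variables (k : fieldType) (n : nat) (F : n.-tuple 'M[k]_n) (h : k).
Variable a : {rmorphism clifford F -> clifford F}.
Hypothesis a_rho : forall p, a (clifford_of_poly F p) = clifford_of_poly F p.
Hypothesis a_x : forall i, a (clifford_x F i) = - clifford_x F i.

Local Notation wseq := (wedge_seq h%:MP (clifford_of_poly F) a (clifford_x F)).

Lemma wedge_seq_homog s : clifford_homog (size s) (wseq s).
Proof.
have x_homog i : free_homog (@letter_deg n) 1 (fvar k (inl i)).
  exact: (@free_homog_var k _ (@letter_deg n) (inl i)).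
elim: s => [|i s [p p_homog wsE]].
  by exists 1; [exact: free_homog1 | rewrite rmorph1].
(* [a] acts on [wseq s] as the sign [(-1) ^+ size s], so [wedge i] lifts to the free algebra with
   this sign in place of [a]. *)
exists (h *: (fvar k (inl i) * p + ((-1) ^+ size s *: p) * fvar k (inl i))).
  apply: free_homogZ; apply: free_homogD.
    exact: (free_homogM (x_homog i) p_homog).
  rewrite /= -addn1; apply: free_homogM; first exact: free_homogZ.
  exact: x_homog.
rewrite /= /wedge (parity_wedge_seq _ a_rho a_x).
rewrite -[LHS]/(clifford_of_poly F h%:MP * (clifford_x F i * wseq s +
  (-1) ^+ size s * wseq s * clifford_x F i)) clifford_of_polyC mulr_algl.
rewrite wsE linearZ rmorphD !rmorphM.
congr (_ *: (_ + _ * _)).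
transitivity ((-1) ^+ size s *: clifford_pi F p); last exact: clifford_pi_scale.
by rewrite -signr_odd -[X in X *: _]signr_odd scaler_sign mulr_sign.
Qed.

End Top.

(** * Normalization of the top form and determination of the center *)

Lemma closed_sqrt (k : closedFieldType) (d : k) : exists c, c ^+ 2 = d.
Proof.
have [|c] := closed_rootP ('X^2 - d%:P) _.
  by rewrite size_XnsubC.
by rewrite /root !hornerE subr_eq0 => /eqP; exists c.
Qed.

Theorem theorem3p18 (k : closedFieldType) (char0 : [pchar k] =i pred0)
    (n : nat) (F : n.-tuple 'M[k]_n)
    (F_sym : forall m : 'I_n, (tnth F m)^T = tnth F m)
    (F_free : free F)
    (det_neq0 : \det (generic_form F) != 0) :
  (~~ odd n ->
     forall z : clifford F,
       ring_center z <-> exists p : {mpoly k[n]}, z = clifford_of_poly F p) /\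
  (odd n ->
     exists g : clifford F,
       [/\ clifford_homog n g,
           g ^+ 2 = clifford_of_poly F (\det (generic_form F)) &
           forall z : clifford F,
             ring_center z <->
             exists p q : {mpoly k[n]},
               z = clifford_of_poly F p + clifford_of_poly F q * g]).
Proof.
have two_neq0 : 2 != 0 :> k by move/pcharf0P: char0 => ->.
pose h : k := 2^-1.
have h_half : h + h = 1 by rewrite -mulr2n -[_ *+ 2]mulr_natr mulVf.
have h_halfR : h%:MP + h%:MP = 1 :> {mpoly k[n]} by rewrite -mpolyCD h_half.
have [a [a_rho a_x]] := clifford_parity F.
have rho_inj := clifford_of_poly_inj h_half F_sym.
have rho_central := @clifford_of_poly_central k n F.
pose w := top_form h%:MP (clifford_of_poly F) a (clifford_x F).
have center_split (z : clifford F) : ring_center z -> exists p q : {mpoly k[n]},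
    z = clifford_of_poly F p + clifford_of_poly F q * w /\
    (~~ odd n -> z = clifford_of_poly F p).
  exact: (center_split h_halfR rho_inj rho_central (clifford_xx_generic F)
  a_rho a_x (@clifford_of_poly_ind k n F) det_neq0).
split=> [n_even z|n_odd].
  split=> [zC|[p ->] u]; last exact: clifford_of_poly_central.
  have [p [q [_ zE]]] := center_split z zC.
  by exists p; exact: zE.
have wC := top_central h_halfR rho_central (clifford_xx_generic F)
  a_rho a_x (@clifford_of_poly_ind k n F) n_odd.
have [e w2] := top_sqr h_halfR rho_central (clifford_xx_generic F)
  a_rho a_x (@clifford_of_poly_ind k n F) n_odd.
(* By [w2] the square of [w] is [d] times the determinant. Since [d] is a nonzero constant, scaling
   [w] by a square root [c] of [d^-1] makes the square exactly the determinant. *)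
pose d : k := (-1) ^+ e * h ^+ n.
have dE : (-1) ^+ e * h%:MP ^+ n = d%:MP :> {mpoly k[n]}.
  by rewrite /d rmorphM !rmorphXn rmorphN rmorph1.
have d0 : d != 0 by rewrite mulf_neq0 ?expf_neq0 ?invr_eq0 ?oppr_eq0 ?oner_neq0.
have [c c2] := closed_sqrt d^-1.
have c0 : c != 0 by apply: contraNneq d0 => c0; rewrite -invr_eq0 -c2 c0 expr0n.
exists (clifford_of_poly F c%:MP * w); split.
(* [w] is built from 1 by [n] wedges, each raising the degree by one. *)
- have [p p_homog wE] := wedge_seq_homog h a_rho a_x (enum 'I_n).
  rewrite size_enum_ord in p_homog; exists (c *: p); first exact: free_homogZ.
  by rewrite clifford_of_polyC mulr_algl -clifford_pi_scale -wE.
- have wc : GRing.comm (clifford_of_poly F c%:MP) w.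
    exact: clifford_of_poly_central.
  rewrite (exprMn_comm 2 wc) w2 -rmorphXn -rmorphM; congr (clifford_of_poly F _).
  rewrite [(-1) ^+ e * _]mulrA dE -rmorphXn c2 mulrA -rmorphM mulVf //.
  by rewrite rmorph1 mul1r.
- move=> z; split=> [zC|[p [q ->]] u].
    have [p [q [zE _]]] := center_split z zC.
    (* As [c] is a unit, a coefficient [q] of [w] becomes the coefficient [c^-1 * q] of the rescaled
       generator. *)
    have qE : clifford_of_poly F (c^-1%:MP * q) * clifford_of_poly F c%:MP =
        clifford_of_poly F q.
      rewrite -(rmorphM (clifford_of_poly F)); congr (clifford_of_poly F _).
      by rewrite mulrAC -mpolyCM mulVf // mpolyC1 mul1r.
    by exists p, (c^-1%:MP * q); rewrite [X in _ + X]mulrA qE.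
  apply/commr_sym/commrD; first exact/commr_sym/clifford_of_poly_central.
  apply: commrM; first exact/commr_sym/clifford_of_poly_central.
  apply: commrM; first exact/commr_sym/clifford_of_poly_central.
  exact/commr_sym/wC.
Qed.
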